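(* Employing the IP (interior penalty) scheme for the one-dimensional diffusion equation $\partial_t u=b\,\Delta u$ with the ESFR (energy stable flux reconstruction) methods, as described in the context, with a constant penalty parameter $\tau$, let $$\tau^*=\frac12\,\max_{n\in\{1,\dots,N_K\}}\left(\frac1{J_n}\right)\ \min_{\kappa}\Big(\left|\nabla_r g_L(1)\right|-\nabla_r g_L(-1)\Big),$$ where the minimum is over the parameter $\kappa$ of the left ESFR correction function $g_L$. If $\tau$ is greater than $\tau^*$, then the scheme is energy stable: $$\frac{d}{dt}\|U\|_{p,c}^2\le 0 .$$
   Context: Mesh: the domain $\Omega$ is partitioned into non-overlapping elements $\Omega_n=[x_n,x_{n+1}]$, $1\le n\le N_K$, with $h_n=x_{n+1}-x_n$ and $J_n=h_n/2$; $\Omega_n$ is the image of $r\in[-1,1]$ under $x=\frac{1-r}{2}x_n+\frac{1+r}{2}x_{n+1}$. On each $\Omega_n$, the numerical solution $u_n$ and the corrected gradient $q_n$ are polynomials of degree $p$ (i.e. at most $p$) in space, with $p\ge1$. Write $\nabla=\partial/\partial x$, $\nabla_r=\partial/\partial r$; $b>0$ is a constant. Correction functions: $\Psi_m$ is the Legendre polynomial of degree $m$ (with $\Psi_m(1)=1$), $a_p=\frac{(2p)!}{2^p(p!)^2}$, $\eta_{p,\kappa}=\frac{\kappa(2p+1)(a_pp!)^2}{2}$. The ESFR correction functions with scalar parameter $\kappa$ are $$g_L=\frac{(-1)^p}{2}\left[\Psi_p-\frac{\eta_{p,\kappa}\Psi_{p-1}+\Psi_{p+1}}{1+\eta_{p,\kappa}}\right],\quad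 g_R=\frac12\left[\Psi_p+\frac{\eta_{p,\kappa}\Psi_{p-1}+\Psi_{p+1}}{1+\eta_{p,\kappa}}\right],$$ and $h_L,h_R$ are given by the same formulas with a scalar parameter $c$ in place of $\kappa$. The parameters $\kappa$ and $c$ range over $]c_-,\infty[$, where $c_-=-\frac{2}{(2p+1)(a_pp!)^2}$ (equivalently $1+\eta_{p,\kappa}>0$ and $1+\eta_{p,c}>0$). Scheme: on every element, $$\frac{\partial u_n}{\partial t}=\frac{b}{J_n}\left[\nabla_r q_n+(q^*-q_n)|_{-1}\nabla_r h_L+(q^*-q_n)|_{1}\nabla_r h_R\right],$$ $$q_n=\frac1{J_n}\left[\nabla_r u_n+(u^*-u_n)|_{-1}\nabla_r g_L+(u^*-u_n)|_{1}\nabla_r g_R\right],$$ where $|_{-1}$ and $|_{1}$ denote evaluation at the left and right endpoints of $\Omega_n$. IP numerical fluxes: at an edge $e$ (interface between elements), let $v_{e,-}$, $v_{e,+}$ be the values of $v$ from the left and right side; $[\![v_e]\!]=v_{e,-}-v_{e,+}$, $\{\{v_e\}\}=\frac12(v_{e,-}+v_{e,+})$. Then $u^*=\{\{u\}\}$ and $q^*=\{\{\nabla u\}\}-\tau[\![u]\!]$, where $\nabla u$ is the elementwise derivative of $u$ in $x$. Energy norm: $$\|U\|_{p,c}=\left\{\sum_{n=1}^{N_K}\int_{x_n}^{x_{n+1}}\left[u_n^2+\frac c2 J_n^{2p}\left(\frac{\partial^p u_n}{\partial x^p}\right)^2\right]dx\right\}^{1/2}.$$ *)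

(* Defs.v *)
From HB Require Import structures.
From mathcomp Require Import all_boot all_order all_algebra.
From mathcomp Require Import all_classical all_reals all_analysis.

Set Implicit Arguments.
Unset Strict Implicit.
Unset Printing Implicit Defensive.

Import Order.TTheory GRing.Theory Num.Theory.
Import numFieldNormedType.Exports.

Local Open Scope classical_set_scope.
Local Open Scope ring_scope.

(* Rodrigues' formula; normalised so that the value at 1 is 1. *)
Definition legendre (R : realType) (m : nat) : {poly R} :=
  (2 ^+ m * m`!%:R)^-1 *: (('X^2 - 1) ^+ m)^`(m).

Definition acoef (R : realType) (p : nat) : R :=
  (2 * p)`!%:R / (2 ^+ p * p`!%:R ^+ 2).

Definition eta (R : realType) (p : nat) (k : R) : R :=
  k * (2 * p + 1)%:R * (acoef R p * p`!%:R) ^+ 2 / 2.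

Definition cminus (R : realType) (p : nat) : R :=
  - (2 / ((2 * p + 1)%:R * (acoef R p * p`!%:R) ^+ 2)).

(* g_L, g_R for k = kappa, and h_L, h_R for k = c. *)
Definition corrL (R : realType) (p : nat) (k : R) : {poly R} :=
  ((-1) ^+ p / 2) *: (legendre R p -
    (1 + eta p k)^-1 *: (eta p k *: legendre R p.-1 + legendre R p.+1)).

Definition corrR (R : realType) (p : nat) (k : R) : {poly R} :=
  2^-1 *: (legendre R p +
    (1 + eta p k)^-1 *: (eta p k *: legendre R p.-1 + legendre R p.+1)).

(* Nodes x 0 < ... < x N; element n : 'I_N is [x n, x n.+1], so elements and
   nodes are numbered from 0. Values of x beyond N are never used. *)
Definition jac (R : realType) (x : nat -> R) (n : nat) : R :=
  (x n.+1 - x n) / 2.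

(* The map r |-> (1 - r)/2 x_n + (1 + r)/2 x_{n+1}, as a polynomial in r. *)
Definition elt_map (R : realType) (x : nat -> R) (n : nat) : {poly R} :=
  (x n / 2) *: (1 - 'X) + (x n.+1 / 2) *: (1 + 'X).

(* A discrete function v is a family of polynomials in the physical variable.
   The mesh is periodic: edge e : 'I_N is the interface between element
   ord_pred e (on its left, cyclically) and element e (on its right), so
   element n has left edge n and right edge ordS n. Each trace is taken at the
   endpoint of the element it comes from, which matters at the edge 0, where
   x 0 and x N are identified. *)
Definition trace_left (R : realType) (N : nat) (x : nat -> R)
  (v : 'I_N -> {poly R}) (e : 'I_N) : R :=
  (v (ord_pred e)).[x (ord_pred e).+1].

Definition trace_right (R : realType) (N : nat) (x : nat -> R)
  (v : 'I_N -> {poly R}) (e : 'I_N) : R := (v e).[x e].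

Definition jump (R : realType) (N : nat) (x : nat -> R)
  (v : 'I_N -> {poly R}) (e : 'I_N) : R :=
  trace_left x v e - trace_right x v e.

Definition avg (R : realType) (N : nat) (x : nat -> R)
  (v : 'I_N -> {poly R}) (e : 'I_N) : R :=
  (trace_left x v e + trace_right x v e) / 2.

Definition ustar (R : realType) (N : nat) (x : nat -> R)
  (u : 'I_N -> {poly R}) (e : 'I_N) : R := avg x u e.

Definition qstar (R : realType) (N : nat) (x : nat -> R) (tau : R)
  (u : 'I_N -> {poly R}) (e : 'I_N) : R :=
  avg x (fun n => (u n)^`()) e - tau * jump x u e.

(* nabla_r v_n + (v^* - v_n)|_{-1} nabla_r f_L + (v^* - v_n)|_1 nabla_r f_R,
   as a polynomial in r. *)
Definition corrected_grad (R : realType) (N : nat) (x : nat -> R)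
  (fL fR : {poly R}) (v : 'I_N -> {poly R}) (vstar : 'I_N -> R)
  (n : 'I_N) : {poly R} :=
  (v n \Po elt_map x n)^`()
  + (vstar n - (v n).[x n]) *: fL^`()
  + (vstar (ordS n) - (v n).[x n.+1]) *: fR^`().

(* u t n and q t n are the numerical solution and the corrected gradient on
   element n at time t > 0. *)
Definition esfr_ip_solution (R : realType) (p N : nat) (x : nat -> R)
  (b kappa c tau : R) (u q : R -> 'I_N -> {poly R}) : Prop :=
  forall t : R, 0 < t -> forall n : 'I_N,
  [/\ (size (u t n) <= p.+1)%N,
      (size (q t n) <= p.+1)%N,
      q t n \Po elt_map x n = (jac x n)^-1 *:
        corrected_grad x (corrL p kappa) (corrR p kappa)
          (u t) (ustar x (u t)) n &
      forall r : R, -1 <= r <= 1 ->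
        is_derive t 1 (fun s : R => (u s n).[(elt_map x n).[r]])
          (b / jac x n *
            (corrected_grad x (corrL p c) (corrR p c)
              (q t) (qstar x tau (u t)) n).[r])].

Definition energy_norm (R : realType) (p N : nat) (x : nat -> R) (c : R)
  (v : 'I_N -> {poly R}) : R :=
  Num.sqrt (\sum_(n < N) Rintegral (@lebesgue_measure R) `[x n, x n.+1]
    (fun y => (v n).[y] ^+ 2
              + c / 2 * jac x n ^+ (2 * p) * ((v n)^`(p)).[y] ^+ 2)).

(* The infimum over kappa is a minimum: the expression equals
   (|p eta - (p + 1)| + p^2 eta + (p + 1)^2) / (2 (1 + eta)), which is
   decreasing in eta up to (p + 1) / p and constant from there on.
   The maximum is over positive numbers, so starting it at 0 is harmless. *)
Definition tau_star (R : realType) (p N : nat) (x : nat -> R) : R :=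
  2^-1 * (\big[Num.max/0]_(n < N) (jac x n)^-1) *
  inf [set `|(corrL p k)^`().[1]| - (corrL p k)^`().[-1]
      | k in [set k : R | cminus R p < k]].

(* Main.v *)
(* Integrating by parts on every element, with the ESFR property
   [int g' f + k f^(p) g^(p+1) = boundary value of f] of the correction
   functions, gives
     (1 / 2b) dE/dt = - sum_n int u_x^2
                      + sum_e (2 [[u]] {{u_x}} - tau [[u]]^2),
   in which neither c nor kappa appears. On an element, u_x has degree at most
   p - 1, so the sum of its squared boundary values is at most
   p (p + 1) / (2 J_n) int u_x^2; absorbing 2 [[u]] {{u_x}} with Young's
   inequality therefore only needs tau >= p (p + 1) / (4 J_n) for all n, and
   |g_L'(1)| - g_L'(-1) >= p (p + 1) / 2 for every parameter.
   The condition c > c_- enters through the nonnegativity of the energy, without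
   which its square root would be the junk value 0. *)
Require Import Defs.
From HB Require Import structures.
From mathcomp Require Import all_boot all_order all_algebra.
From mathcomp Require Import all_classical all_reals all_analysis.
From mathcomp Require Import ring lra.

Import Order.TTheory GRing.Theory Num.Theory.
Import numFieldNormedType.Exports.

Local Open Scope classical_set_scope.
Local Open Scope ring_scope.

(** * Integration of polynomials over [-1, 1] *)

(** At [i = 0] the division by zero yields 0, so the constant of integration vanishes. *)
Definition antideriv {R : realType} (f : {poly R}) : {poly R} :=
  \poly_(i < (size f).+1) (f`_i.-1 / i%:R).

(** Kept algebraic, so that linearity and integration by parts are polynomial identities;
    [Rintegral_horner] makes the link with the Lebesgue integral. *)
Definition pint {R : realType} (f : {poly R}) : R :=
  (antideriv f).[1] - (antideriv f).[-1].

Lemma coef_antideriv {R : realType} (f : {poly R}) i :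
  (antideriv f)`_i = f`_i.-1 / i%:R.
Proof.
rewrite coef_poly; case: ltnP => // h.
by rewrite nth_default ?mul0r // -ltnS prednK // (leq_trans _ h).
Qed.

Lemma antiderivK {R : realType} (f : {poly R}) : (antideriv f)^`() = f.
Proof.
by apply/polyP => i; rewrite coef_deriv -mulr_natr coef_antideriv divfK.
Qed.

Lemma antideriv_deriv {R : realType} (f : {poly R}) :
  antideriv f^`() = f - (f`_0)%:P.
Proof.
apply/polyP => -[|i]; rewrite coef_antideriv coefB coefC /=.
  by rewrite invr0 mulr0 subrr.
by rewrite coef_deriv -[f`_i.+1 *+ _]mulr_natr mulfK ?subr0.
Qed.

Fact pint_is_linear {R : realType} : scalar (@pint R).
Proof.
move=> a f g; rewrite /pint.
have -> : antideriv (a *: f + g) = a *: antideriv f + antideriv g.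
  apply/polyP => i.
  by rewrite coefD coefZ !coef_antideriv coefD coefZ mulrDl mulrA.
rewrite !hornerE /=; ring.
Qed.
HB.instance Definition _ (R : realType) :=
  GRing.isLinear.Build R {poly R} R _ (@pint R) (@pint_is_linear R).

Lemma pintD {R : realType} (f g : {poly R}) : pint (f + g) = pint f + pint g.
Proof. exact: linearD. Qed.

Lemma pintB {R : realType} (f g : {poly R}) : pint (f - g) = pint f - pint g.
Proof. exact: linearB. Qed.

Lemma pintZ {R : realType} (a : R) (f : {poly R}) : pint (a *: f) = a * pint f.
Proof. exact: linearZ. Qed.

Lemma pint_deriv {R : realType} (f : {poly R}) :
  pint f^`() = f.[1] - f.[-1].
Proof. rewrite /pint antideriv_deriv !hornerE; ring. Qed.

Lemma pint_by_parts {R : realType} (f g : {poly R}) :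
  pint (f^`() * g) = f.[1] * g.[1] - f.[-1] * g.[-1] - pint (f * g^`()).
Proof. by rewrite -!hornerM -pint_deriv derivM pintD addrK. Qed.

Lemma pint_sqr_ge0 {R : realType} (f : {poly R}) : 0 <= pint (f * f).
Proof.
rewrite subr_ge0.
apply: (@ger0_derive1_le_cc R (horner (antideriv (f * f))) (-1) 1).
- by move=> y _; exact: derivable_horner.
- by move=> y _; rewrite -derivE antiderivK hornerM -expr2 sqr_ge0.
- exact/continuous_subspaceT/continuous_horner.
- by rewrite in_itv /=; apply/andP; split; lra.
- by rewrite in_itv /=; apply/andP; split; lra.
- by lra.
Qed.

Lemma Rintegral_horner {R : realType} (f : {poly R}) (a b : R) : a < b ->
  Rintegral (@lebesgue_measure R) `[a, b] (horner f)
  = (antideriv f).[b] - (antideriv f).[a].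
Proof.
move=> ab; rewrite /Rintegral (@continuous_FTC2 _ _ (horner (antideriv f))) //.
- exact/continuous_subspaceT/continuous_horner.
- split=> [y _||]; first exact: derivable_horner.
    exact/cvg_at_right_filter/continuous_horner.
  exact/cvg_at_left_filter/continuous_horner.
- by move=> y _; rewrite -derivE antiderivK.
Qed.

(** * Legendre polynomials *)

Lemma derivn_comp_XaddC {R : realType} (f : {poly R}) (a : R) n :
  (f \Po ('X + a%:P))^`(n) = f^`(n) \Po ('X + a%:P).
Proof.
elim: n => [|n IHn]; first by rewrite !derivn0.
by rewrite !derivnS IHn deriv_comp derivD derivX derivC addr0 mulr1.
Qed.

(** Taylor's formula at [a]: derivatives at the endpoints can be read off as coefficients of a
    shifted polynomial. *)
Lemma horner_derivn {R : realType} (f : {poly R}) (a : R) n :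
  f^`(n).[a] = n`!%:R * (f \Po ('X + a%:P))`_n.
Proof.
have -> : f^`(n).[a] = (f^`(n) \Po ('X + a%:P)).[0].
  by rewrite horner_comp !hornerE.
rewrite -derivn_comp_XaddC horner_coef0 coef_derivn addn0 ffactnn.
by rewrite mulr_natl.
Qed.

(** With [a] equal to 1 or -1, (X + a)^2 - 1 = X (X + 2a), which exhibits the zero of order [m] at
    each endpoint. *)
Lemma comp_sqrX_sub1_exp {R : realType} (a : R) m : a ^+ 2 = 1 ->
  (('X^2 - 1) ^+ m) \Po ('X + a%:P) = 'X^m * ('X + (2 * a)%:P) ^+ m.
Proof.
move=> a2; rewrite rmorphXn /= -exprMn; congr (_ ^+ m).
rewrite comp_polyB comp_polyC rmorphXn /= comp_polyX.
have : a%:P ^+ 2 = 1 :> {poly R} by rewrite -polyC_exp a2.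
rewrite polyCM; move: a%:P => A A2.
have -> : 2%:P = 2 :> {poly R} by rewrite polyC_natr.
by rewrite polyC1; ring: A2.
Qed.

Lemma coef0_XaddC_exp {R : realType} (a : R) m :
  (('X + a%:P) ^+ m)`_0 = a ^+ m.
Proof. by rewrite -horner_coef0 horner_exp !hornerE. Qed.

Lemma coef1_XaddC_exp {R : realType} (a : R) m :
  (('X + a%:P) ^+ m)`_1 = m%:R * a ^+ m.-1.
Proof.
have -> : (('X + a%:P) ^+ m)`_1 = (('X + a%:P) ^+ m)^`()`_0.
  by rewrite coef_deriv.
rewrite deriv_exp derivD derivX derivC addr0 mul1r coefMn coef0_XaddC_exp.
by rewrite mulr_natl.
Qed.

Lemma derivn_sqrX_sub1_exp0 {R : realType} (a : R) m k : a ^+ 2 = 1 ->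
  (k < m)%N -> (('X^2 - 1) ^+ m)^`(k).[a] = 0.
Proof.
by move=> a2 km; rewrite horner_derivn comp_sqrX_sub1_exp // coefXnM km mulr0.
Qed.

Lemma legendre_scale_neq0 {R : realType} m : 2 ^+ m * m`!%:R != 0 :> R.
Proof.
by rewrite mulf_neq0 ?expf_neq0 ?pnatr_eq0 // -lt0n fact_gt0.
Qed.

Lemma horner_legendre {R : realType} (a : R) m : a ^+ 2 = 1 ->
  (legendre R m).[a] = a ^+ m.
Proof.
move=> a2; rewrite hornerZ horner_derivn comp_sqrX_sub1_exp //.
rewrite coefXnM ltnn subnn coef0_XaddC_exp exprMn.
by rewrite [m`!%:R * _]mulrCA mulrA mulKf ?legendre_scale_neq0.
Qed.

Lemma horner_deriv_legendre {R : realType} (a : R) m : a ^+ 2 = 1 ->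
  (legendre R m)^`().[a] = (m * m.+1)%:R / 2 * a ^+ m.-1.
Proof.
move=> a2; rewrite derivZ -derivnS hornerZ horner_derivn comp_sqrX_sub1_exp //.
rewrite coefXnM ltnNge leqnSn /= subSn // subnn coef1_XaddC_exp exprMn.
have := @legendre_scale_neq0 R m.
case: m => [|m] h; first by rewrite mul0n !mul0r !mulr0.
rewrite (factS m.+1) (factS m) !natrM exprS /= in h *; move: h.
rewrite !mulf_eq0 !negb_or => /andP[/andP[_ h1] /andP[h2 h3]].
move: (2 ^+ m) (m.+1%:R) (m.+2%:R) (m`!%:R) h1 h2 h3 => A B C D h1 h2 h3.
by field; rewrite h1 h2 h3.
Qed.

Lemma size_sqrX_sub1_exp {R : realType} m :
  size (('X^2 - 1) ^+ m : {poly R}) = (2 * m).+1.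
Proof.
have mon := monic_exp m (monicXnsubC (1 : R) (isT : 0 < 2)%N).
by rewrite -[LHS]prednK ?size_poly_gt0 ?monic_neq0 // size_exp size_XnsubC.
Qed.

Lemma coef_legendre_gt {R : realType} m i : (m < i)%N -> (legendre R m)`_i = 0.
Proof.
move=> mi; rewrite coefZ coef_derivn nth_default ?mul0rn ?mulr0 //.
by rewrite size_sqrX_sub1_exp mul2n -addnn ltn_add2l.
Qed.

Lemma size_legendre {R : realType} m : (size (legendre R m) <= m.+1)%N.
Proof. by apply/leq_sizeP => i mi; exact: coef_legendre_gt. Qed.

Lemma coef_legendre {R : realType} m : (legendre R m)`_m = acoef R m.
Proof.
rewrite coefZ coef_derivn addnn -mul2n.
have -> : (('X^2 - 1) ^+ m : {poly R})`_(2 * m) = 1.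
  have /monicP := monic_exp m (monicXnsubC (1 : R) (isT : 0 < 2)%N).
  by rewrite /lead_coef size_sqrX_sub1_exp.
rewrite /acoef.
have -> : (2 * m)`! = ((2 * m) ^_ m * m`!)%N.
  by rewrite mul2n -addnn -(ffact_fact (leq_addr m m)) addnK.
rewrite natrM; have := @legendre_scale_neq0 R m.
by rewrite mulf_eq0 negb_or => /andP[h1 h2]; field; rewrite h1 h2.
Qed.

(** Rodrigues' formula is integrated by parts [m] times. The boundary terms vanish because of the
    zeros of order [m] at the endpoints, and the sign turns X^2 - 1 into 1 - X^2. *)
Lemma pint_legendre {R : realType} m (f : {poly R}) :
  pint (legendre R m * f) =
  (2 ^+ m * m`!%:R)^-1 * pint ((1 - 'X^2) ^+ m * f^`(m)).
Proof.
rewrite -scalerAl pintZ; congr (_ * _).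
have -> : (1 - 'X^2) ^+ m = (-1) ^+ m *: ('X^2 - 1) ^+ m :> {poly R}.
  rewrite -(opprB 'X^2 1) (exprNn ('X^2 - 1)) -[RHS]mul_polyC.
  by rewrite polyC_exp polyCN polyC1.
rewrite -scalerAl pintZ.
(* Induction on the number of integrations by parts; [g] is arbitrary because each of them
   differentiates it. *)
suff H k : (k <= m)%N -> forall g : {poly R},
    pint ((('X^2 - 1) ^+ m)^`(k) * g)
    = (-1) ^+ k * pint (('X^2 - 1) ^+ m * g^`(k)) by exact: H.
elim: k => [|k IHk] km g; first by rewrite !derivn0 expr0 mul1r.
rewrite derivnS pint_by_parts !derivn_sqrX_sub1_exp0 ?sqrrN ?expr1n //.
by rewrite !mul0r subrr sub0r IHk 1?ltnW // -derivSn (exprS (-1)) mulN1r mulNr.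
Qed.

Lemma pint_legendre_small {R : realType} m (f : {poly R}) :
  (size f <= m)%N -> pint (legendre R m * f) = 0.
Proof.
by move=> fm; rewrite pint_legendre derivn_poly0 // mulr0 linear0 mulr0.
Qed.

(** X (1 - X^2)^(m+1) vanishes at both endpoints, so its derivative has integral 0; this gives the
    recurrence (2m + 3) I_(m+1) = (2m + 2) I_m. *)
Lemma pint_one_sub_sqrX_exp {R : realType} m :
  pint ((1 - 'X^2) ^+ m : {poly R})
  = 2 ^+ (2 * m).+1 * m`!%:R ^+ 2 / (2 * m).+1`!%:R.
Proof.
elim: m => [|m IHm].
  have -> : (1 - 'X^2) ^+ 0 = ('X)^`() :> {poly R} by rewrite expr0 derivX.
  rewrite pint_deriv !hornerX opprK muln0 (factS 0) fact0 muln1 expr1 expr1n.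
  by rewrite mulr1 divr1.
have : pint ('X * (1 - 'X^2) ^+ m.+1 : {poly R})^`() = 0.
  by rewrite pint_deriv !hornerE sqrrN expr1n subrr expr0n !mulr0 subrr.
have -> : ('X * (1 - 'X^2) ^+ m.+1 : {poly R})^`() =
    (2 * m + 3)%:R *: (1 - 'X^2) ^+ m.+1 - (2 * m + 2)%:R *: (1 - 'X^2) ^+ m.
  rewrite derivM derivX mul1r deriv_exp derivB derivXn (derivC 1) sub0r /=.
  rewrite !scaler_nat -[in RHS]mulr_natl -[in RHS](mulr_natl _ (2 * m + 2)).
  by rewrite (exprS _ m); ring.
rewrite pintB !pintZ IHm => /eqP; rewrite subr_eq0 => /eqP h.
rewrite mulnS (factS m) (factS (2 * m).+2) (factS (2 * m).+1) !(exprS 2).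
move: h; rewrite addn2 addn3 => h.
have A0 : (2 * m).+1`!%:R != 0 :> R by rewrite pnatr_eq0 -lt0n fact_gt0.
have d0 : (2 * m).+3%:R != 0 :> R by rewrite pnatr_eq0.
have e0 : (2 * m).+2%:R != 0 :> R by rewrite pnatr_eq0.
have em : m.+1%:R = (2 * m).+2%:R / 2 :> R.
  have -> : (2 * m).+2 = (m.+1 * 2)%N by rewrite [RHS]mulnC mulnS.
  by rewrite natrM mulfK.
apply: (mulfI d0); rewrite h (exprS 2 (2 * m)).
move: ((2 * m).+1`!) A0 (m`!) (2 ^+ (2 * m)) => A A0 B C.
move: (m.+1) (2 * m).+2 (2 * m).+3 d0 e0 em => k e d d0 e0 em.
by rewrite !natrM em; field; rewrite A0 d0 e0.
Qed.

Lemma acoef_gt0 {R : realType} m : 0 < acoef R m.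
Proof.
by rewrite divr_gt0 ?mulr_gt0 ?exprn_gt0 ?ltr0n ?fact_gt0.
Qed.

Lemma acoefS {R : realType} m :
  acoef R m.+1 = acoef R m * (2 * m).+1%:R / m.+1%:R.
Proof.
rewrite /acoef mulnS (factS m) (factS (2 * m).+1) (factS (2 * m)) (exprS 2).
have A0 : (m`!)%:R != 0 :> R by rewrite pnatr_eq0 -lt0n fact_gt0.
have d0 : m.+1%:R != 0 :> R by rewrite pnatr_eq0.
have em : (2 * m).+2%:R = 2 * m.+1%:R :> R by rewrite -natrM mulnS.
have B0 : 2 ^+ m != 0 :> R by rewrite expf_neq0.
move: (2 ^+ m) (m`!) A0 B0 ((2 * m)`!) => B A A0 B0 C.
rewrite (natrM _ (2 * m).+2) em !(natrM _ _ A).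
rewrite (natrM _ (2 * m).+1); move: (2 * m).+1 (m.+1) d0 => e d d0.
by field; rewrite A0 B0 d0.
Qed.

Lemma derivn_lead {R : realType} p (f : {poly R}) : (size f <= p.+1)%N ->
  f^`(p) = (p`!%:R * f`_p)%:P.
Proof.
move=> fp; apply/polyP => i; rewrite coef_derivn coefC.
case: i => [|i]; first by rewrite addn0 ffactnn mulr_natl.
by rewrite nth_default ?mul0rn // (leq_trans fp) // addnS ltnS leq_addr.
Qed.

Lemma pint_legendre_lead {R : realType} m (f : {poly R}) : (size f <= m.+1)%N ->
  pint (legendre R m * f) = 2 / ((2 * m).+1%:R * acoef R m) * f`_m.
Proof.
move=> fm; rewrite pint_legendre derivn_lead // [_ * _%:P]mulrC mul_polyC.
rewrite pintZ pint_one_sub_sqrX_exp /acoef.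
rewrite (factS (2 * m)) (exprS _ (2 * m)) mul2n -addnn exprD.
have A0 : (m`!)%:R != 0 :> R by rewrite pnatr_eq0 -lt0n fact_gt0.
have d0 : (m + m)`!%:R != 0 :> R by rewrite pnatr_eq0 -lt0n fact_gt0.
have e0 : (m + m).+1%:R != 0 :> R by rewrite pnatr_eq0.
have B0 : 2 ^+ m != 0 :> R by rewrite expf_neq0.
move: (2 ^+ m) (m`!) A0 B0 ((m + m)`!) d0 => B A A0 B0 C C0.
rewrite natrM; move: (m + m).+1 e0 => d d0.
by field; rewrite A0 B0 C0 d0.
Qed.

Lemma pint_legendre_sqr {R : realType} m :
  pint (legendre R m * legendre R m) = 2 / (2 * m).+1%:R.
Proof.
rewrite pint_legendre_lead ?size_legendre // coef_legendre.
have a0 := lt0r_neq0 (@acoef_gt0 R m).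
have e0 : (2 * m).+1%:R != 0 :> R by rewrite pnatr_eq0.
by move: (_.+1%:R) e0 => d d0; field; rewrite a0 d0.
Qed.

(** * Trace inequality for polynomials *)

Lemma size_deriv_le {R : nzRingType} (f : {poly R}) n :
  (size f <= n.+1)%N -> (size f^`() <= n)%N.
Proof.
move=> fn; apply/leq_sizeP => i ni.
by rewrite coef_deriv nth_default ?mul0rn // (leq_trans fn).
Qed.

(* The derivatives of two consecutive Legendre polynomials are orthogonal, and
   integrating [w] against them returns the sum and the difference of the
   boundary values; the inequality is Bessel's for this pair. *)
Lemma polynomial_trace {R : realType} p (w : {poly R}) : (0 < p)%N ->
  (size w <= p)%N ->
  w.[1] ^+ 2 + w.[-1] ^+ 2 <= (p * p.+1)%:R / 2 * pint (w * w).
Proof.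
case: p => // m _ wm.
have N1 : (-1) ^+ 2 = 1 :> R by rewrite sqrrN expr1n.
have P1 : 1 ^+ 2 = 1 :> R by rewrite expr1n.
pose A := (legendre R m.+1)^`(); pose B := (legendre R m)^`().
set e : R := (-1) ^+ m.
have ee : e * e = 1 by rewrite -expr2 sqrr_sign.
have sw : (size w^`() <= m)%N by exact: size_deriv_le.
have sB : (size B^`() <= m)%N.
  apply: size_deriv_le; apply: leqW; apply: size_deriv_le.
  exact: size_legendre.
have hA f : pint (A * f) = f.[1] + e * f.[-1]
    - pint (legendre R m.+1 * f^`()).
  by rewrite pint_by_parts !horner_legendre // expr1n exprS -/e; ring.
have hB f : pint (B * f) = f.[1] - e * f.[-1] - pint (legendre R m * f^`()).
  by rewrite pint_by_parts !horner_legendre // expr1n -/e; ring.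
have hAw : pint (A * w) = w.[1] + e * w.[-1].
  by rewrite hA pint_legendre_small ?subr0 // (leq_trans sw).
have hBw : pint (B * w) = w.[1] - e * w.[-1].
  by rewrite hB pint_legendre_small ?subr0.
have hAA : pint (A * A) = (m.+1 * m.+2)%:R.
  rewrite hA pint_legendre_small; last first.
    by apply: leqW; do 2!apply: size_deriv_le; exact: size_legendre.
  by rewrite !horner_deriv_legendre //= expr1n mulrCA ee; field.
have hAB : pint (A * B) = 0.
  rewrite hA pint_legendre_small ?(leq_trans sB) //.
  rewrite !horner_deriv_legendre //= expr1n mulrCA /e.
  case: (m) => [|n]; first by rewrite mul0n !mul0r !(subr0, addr0).
  by rewrite /= exprS -(mulrA (-1)) -expr2 sqrr_sign; ring.
have hBB : pint (B * B) = (m * m.+1)%:R.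
  rewrite hB pint_legendre_small //.
  rewrite !horner_deriv_legendre //= expr1n mulrCA /e.
  case: (m) => [|n]; first by rewrite mul0n !mul0r !(subr0, addr0).
  by rewrite /= exprS -(mulrA (-1)) -expr2 sqrr_sign; field.
have d0 : 0 < (m.+1 * m.+2)%:R :> R by rewrite ltr0n.
have dm : (m * m.+1)%:R <= (m.+1 * m.+2)%:R :> R by rewrite ler_nat leq_mul.
set S := w.[1] + e * w.[-1] in hAw; set T := w.[1] - e * w.[-1] in hBw.
have ST : w.[1] ^+ 2 + w.[-1] ^+ 2 = (S ^+ 2 + T ^+ 2) / 2.
  by rewrite /S /T; field: ee.
rewrite ST; move: (_%:R) d0 dm hAA => d d0 dm hAA.
(* The coefficient 1/d is exact for [A], whose squared norm is [d]. Using it for [B] too, whose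
   squared norm m (m + 1) is smaller and may be 0, only loses a nonnegative term. *)
pose l := d^-1.
have := pint_sqr_ge0 (w - (l * S) *: A - (l * T) *: B).
have -> : (w - (l * S) *: A - (l * T) *: B) *
    (w - (l * S) *: A - (l * T) *: B) =
    w * w - (2 * l * S) *: (A * w) - (2 * l * T) *: (B * w)
    + (2 * l ^+ 2 * S * T) *: (A * B)
    + (l ^+ 2 * S ^+ 2) *: (A * A) + (l ^+ 2 * T ^+ 2) *: (B * B).
  by rewrite -!mul_polyC !polyCM; ring.
rewrite !(pintB, pintD, pintZ) hAw hBw hAA hAB hBB mulr0 addr0 => h.
have {}h : 0 <= pint (w * w) - (S ^+ 2 + T ^+ 2) / d.
  apply: (le_trans h); rewrite -subr_ge0.
  have -> : pint (w * w) - (S ^+ 2 + T ^+ 2) / d -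
     (pint (w * w) - 2 * l * S * S - 2 * l * T * T
      + l ^+ 2 * S ^+ 2 * d + l ^+ 2 * T ^+ 2 * (m * m.+1)%:R)
     = l ^+ 2 * T ^+ 2 * (d - (m * m.+1)%:R).
    by rewrite /l; move: ((m * m.+1)%:R) => z; field; rewrite gt_eqF.
  by rewrite mulr_ge0 ?subr_ge0 // -exprMn sqr_ge0.
rewrite -mulrA [2^-1 * _]mulrC mulrA ler_pM2r ?invr_gt0 ?ltr0n //.
by rewrite mulrC -ler_pdivrMr // -subr_ge0.
Qed.

(** * ESFR correction functions *)

Lemma cminus_lt {R : realType} p (k : R) :
  (cminus R p < k) = (0 < 1 + Defs.eta p k).
Proof.
rewrite /cminus /Defs.eta addn1.
have : 0 < (2 * p).+1%:R * (acoef R p * p`!%:R) ^+ 2.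
  by rewrite mulr_gt0 ?exprn_gt0 ?mulr_gt0 ?acoef_gt0 ?ltr0n ?fact_gt0.
rewrite -(mulrA k); move: (_ * _ ^+ 2) => D D0.
rewrite -subr_gt0 opprK -(pmulr_rgt0 _ D0) mulrDr mulrCA divff ?gt_eqF //.
have -> : 1 + k * D / 2 = (D * k + 2 * 1) / 2 by field.
by rewrite pmulr_lgt0 // invr_gt0.
Qed.

(** Removing from [f] its Legendre component of degree [p] leaves a remainder whose squared norm is
    exactly the left-hand side with [c] replaced by [cminus R p]. *)
Lemma energy_ge0 {R : realType} p (c : R) (f : {poly R}) :
  cminus R p < c -> (size f <= p.+1)%N ->
  0 <= pint (f * f) + c * (p`!%:R * f`_p) ^+ 2.
Proof.
move=> hc fp; have a0 := @acoef_gt0 R p.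
set l := f`_p / acoef R p.
have := pint_sqr_ge0 (f - l *: legendre R p).
have -> : (f - l *: legendre R p) * (f - l *: legendre R p) =
    f * f - (2 * l) *: (legendre R p * f)
    + l ^+ 2 *: (legendre R p * legendre R p).
  rewrite -!mul_polyC !polyCM; ring.
rewrite pintD pintB !pintZ pint_legendre_lead // pint_legendre_sqr /l.
have d0 : 0 < (2 * p).+1%:R :> R by rewrite ltr0n.
have e0 : 0 < p`!%:R :> R by rewrite ltr0n fact_gt0.
move: hc; rewrite /cminus addn1.
move: (acoef R p) a0 (p`!%:R) e0 (_.+1%:R) d0 (f`_p) => a a0 e e0 d d0 y.
move=> hc h; apply: (le_trans h).
have -> : pint (f * f) - 2 * (y / a) * (2 / (d * a) * y)
      + (y / a) ^+ 2 * (2 / d)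
    = pint (f * f) + - (2 / (d * (a * e) ^+ 2)) * (e * y) ^+ 2.
  by field; rewrite !gt_eqF.
by rewrite lerD2l ler_wpM2r ?sqr_ge0 // ltW.
Qed.

(** The part common to both correction functions, and the only one that depends on the parameter. *)
Definition esfr_avg {R : realType} p (k : R) : {poly R} :=
  (1 + Defs.eta p k)^-1 *:
  (Defs.eta p k *: legendre R p.-1 + legendre R p.+1).

Section EsfrCorrection.
Context {R : realType} {p : nat} {k : R}.
Hypotheses (p_gt0 : (0 < p)%N) (hk : cminus R p < k).

Let eta1_neq0 : 1 + Defs.eta p k != 0.
Proof. by rewrite gt_eqF // -cminus_lt. Qed.

(** The degrees p - 1 and p + 1 have the same parity, so both Legendre polynomials have the same
    endpoint value, and the weights sum to 1. *)
Lemma horner_esfr_avg (a : R) : a ^+ 2 = 1 -> (esfr_avg p k).[a] = a ^+ p.+1.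
Proof.
move=> a2; rewrite hornerZ hornerD hornerZ !horner_legendre //.
case: (p) p_gt0 eta1_neq0 => // m _ h; rewrite /= !exprS mulrA -expr2 a2 mul1r.
by field.
Qed.

(** The core of the ESFR property. Against f', of degree at most p - 1, the component of degree p +
    1 is orthogonal and the one of degree p - 1 sees only the leading coefficient. *)
Lemma pint_esfr_avg (f : {poly R}) : (size f <= p.+1)%N ->
  pint (esfr_avg p k * f^`()) =
  k * p`!%:R ^+ 2 * f`_p * (esfr_avg p k)^`()`_p.
Proof.
case: p p_gt0 eta1_neq0 => // m _ h fm.
have sf := size_deriv_le _ _ fm.
rewrite /esfr_avg /= -scalerAl pintZ mulrDl pintD -scalerAl pintZ.
rewrite pint_legendre_lead // pint_legendre_small ?(leq_trans sf) // addr0.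
rewrite !coef_deriv coefZ coefD coefZ coef_legendre coef_legendre_gt // mulr0.
rewrite add0r -!(mulr_natr (_ * _)) -(mulr_natr f`_m.+1).
have a0 := lt0r_neq0 (@acoef_gt0 R m).
have e1 : (2 * m).+1%:R != 0 :> R by rewrite pnatr_eq0.
have e2 : m.+1%:R != 0 :> R by rewrite pnatr_eq0.
(* The value of [eta] is chosen for this identity, which follows from the ratios of successive
   [acoef]. *)
have -> : Defs.eta m.+1 k *
    (2 / ((2 * m).+1%:R * acoef R m) * (f`_m.+1 * m.+1%:R))
    = k * m.+1`!%:R ^+ 2 * f`_m.+1 * (acoef R m.+2 * m.+2%:R).
  rewrite /Defs.eta (acoefS m.+1) divfK // acoefS addn1.
  move: (2 * m.+1).+1 (2 * m).+1 (m.+1) e1 e2 => d e b e0 b0.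
  by field; rewrite a0 e0 b0.
by ring.
Qed.

Lemma deriv_esfr_avg1 :
  (esfr_avg p k)^`().[-1] = (-1) ^+ p * (esfr_avg p k)^`().[1].
Proof.
rewrite derivZ !hornerZ derivD derivZ !hornerD !hornerZ.
rewrite !horner_deriv_legendre ?sqrrN ?expr1n //.
case: (p) p_gt0 => [//|[|n]] _ /=; first by rewrite mul0n !mul0r; ring.
rewrite !exprS; have := sqrr_sign R n; move: ((-1) ^+ n) => e.
by rewrite expr2 => ee; ring.
Qed.

Lemma horner_corrL1 : (corrL p k).[1] = 0.
Proof.
rewrite /corrL -/(esfr_avg p k) hornerZ hornerD hornerN.
rewrite horner_esfr_avg ?expr1n //.
by rewrite horner_legendre ?expr1n // subrr mulr0.
Qed.

Lemma horner_corrLN1 : (corrL p k).[-1] = 1.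
Proof.
rewrite /corrL -/(esfr_avg p k) hornerZ hornerD hornerN.
rewrite horner_esfr_avg ?sqrrN ?expr1n //.
rewrite horner_legendre ?sqrrN ?expr1n // exprS.
by have := sqrr_sign R p; rewrite expr2; move: ((-1) ^+ p) => e ee; field: ee.
Qed.

Lemma horner_corrR1 : (corrR p k).[1] = 1.
Proof.
rewrite /corrR -/(esfr_avg p k) hornerZ hornerD.
rewrite horner_esfr_avg ?expr1n //.
by rewrite horner_legendre ?expr1n //; field.
Qed.

Lemma horner_corrRN1 : (corrR p k).[-1] = 0.
Proof.
rewrite /corrR -/(esfr_avg p k) hornerZ hornerD.
rewrite horner_esfr_avg ?sqrrN ?expr1n //.
by rewrite horner_legendre ?sqrrN ?expr1n // exprS; ring.
Qed.

(** After integration by parts, Legendre's polynomial of degree [p] is orthogonal to f', and by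
    [pint_esfr_avg] the rest cancels the term in [k]; only a boundary value of [f] survives. *)
Lemma pint_deriv_corrL (f : {poly R}) : (size f <= p.+1)%N ->
  pint ((corrL p k)^`() * f) + k * p`!%:R ^+ 2 * f`_p * (corrL p k)^`()`_p
  = - f.[-1].
Proof.
move=> fp; rewrite pint_by_parts horner_corrL1 horner_corrLN1.
have := pint_esfr_avg f fp; rewrite /corrL -/(esfr_avg p k).
move: (esfr_avg p k) => T hT; rewrite -scalerAl pintZ mulrBl pintB hT.
rewrite pint_legendre_small ?size_deriv_le // derivZ coefZ derivB coefB.
by rewrite (coef_deriv (legendre R p)) coef_legendre_gt // mul0rn; ring.
Qed.

Lemma pint_deriv_corrR (f : {poly R}) : (size f <= p.+1)%N ->
  pint ((corrR p k)^`() * f) + k * p`!%:R ^+ 2 * f`_p * (corrR p k)^`()`_p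
  = f.[1].
Proof.
move=> fp; rewrite pint_by_parts horner_corrR1 horner_corrRN1.
have := pint_esfr_avg f fp; rewrite /corrR -/(esfr_avg p k).
move: (esfr_avg p k) => T hT; rewrite -scalerAl pintZ mulrDl pintD hT.
rewrite pint_legendre_small ?size_deriv_le // derivZ coefZ derivD coefD.
by rewrite (coef_deriv (legendre R p)) coef_legendre_gt // mul0rn; ring.
Qed.

(** Let P = p (p + 1) / 2 and let A be the derivative of [esfr_avg] at 1. By parity the right-hand
    side is (|P - A| + P + A) / 2, and |P - A| >= P - A. *)
Lemma deriv_corrL_gap :
  (p * p.+1)%:R / 2 <= `|(corrL p k)^`().[1]| - (corrL p k)^`().[-1].
Proof.
have := deriv_esfr_avg1; rewrite /corrL -/(esfr_avg p k).
move: (esfr_avg p k) => T hT.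
rewrite derivZ derivB !(hornerZ, hornerD, hornerN).
rewrite hT !horner_deriv_legendre ?sqrrN ?expr1n //.
move: (T^`().[1]) ((p * p.+1)%:R / 2) => A P.
have -> : (-1) ^+ p.-1 = - (-1) ^+ p :> R.
  by case: (p) p_gt0 => // m _; rewrite exprS mulN1r opprK.
rewrite normrM normrM normr_sign mul1r.
have -> : (-1) ^+ p / 2 * (P * - (-1) ^+ p - (-1) ^+ p * A)
    = - ((-1) ^+ p * (-1) ^+ p) * (P + A) / 2 :> R by field.
rewrite -expr2 sqrr_sign ger0_norm //.
have := ler_norm (P * 1 - A); lra.
Qed.

Lemma size_corrL : (size (corrL p k) <= p.+2)%N.
Proof.
apply/leq_sizeP => i pi.
have := @coef_legendre_gt R _ _ (ltnW pi).
have := @coef_legendre_gt R _ _ pi.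
have := @coef_legendre_gt R p.-1 i (leq_ltn_trans (leq_pred p) (ltnW pi)).
rewrite /corrL; move: (legendre R p.-1) (legendre R p) (legendre R p.+1).
by move=> A B C hA hC hB; rewrite !(coefZ, coefD, coefN) hA hB hC; ring.
Qed.

Lemma size_corrR : (size (corrR p k) <= p.+2)%N.
Proof.
apply/leq_sizeP => i pi.
have := @coef_legendre_gt R _ _ (ltnW pi).
have := @coef_legendre_gt R _ _ pi.
have := @coef_legendre_gt R p.-1 i (leq_ltn_trans (leq_pred p) (ltnW pi)).
rewrite /corrR; move: (legendre R p.-1) (legendre R p) (legendre R p.+1).
by move=> A B C hA hC hB; rewrite !(coefZ, coefD, coefN) hA hB hC; ring.
Qed.

End EsfrCorrection.

(** * Energy of an element *)

Lemma scalar_sum {R : realType} (B : {poly R} -> R) n (a : 'I_n -> R)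
    (l : 'I_n -> {poly R}) : scalar B ->
  B (\sum_(i < n) (a i)%:P * l i) = \sum_(i < n) a i * B (l i).
Proof.
move=> hB; have B0 : B 0 = 0.
  by have := hB (-1) 0 0; rewrite scaler0 addr0 mulN1r addNr.
elim/big_rec2: _ => // i y z _ <-; rewrite mul_polyC; exact: hB.
Qed.

(* Lagrange interpolation at fixed nodes turns the form into a quadratic
   polynomial in the values at the nodes, whose time derivatives are given. *)
Lemma is_derive_quadratic {R : realType} (B : {poly R} -> {poly R} -> R)
    (V : R -> {poly R}) (W : {poly R}) (t : R) (n : nat) :
  (forall f, scalar (B f)) -> (forall f g, B f g = B g f) ->
  (\forall s \near t, size (V s) <= n.+1)%N -> (size W <= n.+1)%N ->
  (forall r : R, -1 <= r <= 1 ->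
    is_derive t 1 (fun s : R => (V s).[r]) W.[r]) ->
  is_derive t 1 (fun s : R => B (V s) (V s)) (2 * B (V t) W).
Proof.
move=> linB symB sV sW dV.
(* Distinct nodes inside [-1, 1], where the time derivative of [V] is known. *)
pose x (j : nat) : R := j.+1%:R^-1.
have x_inj : injective x.
  by move=> i j /invr_inj /eqP; rewrite eqr_nat => /eqP [].
have x_itv j : -1 <= x j <= 1.
  rewrite (le_trans (lerN10 _)) ?invr_ge0 ?ler0n //=.
  by rewrite invf_le1 ?ltr0n // ler1n.
pose l (j : 'I_n.+1) : {poly R} := tnth (lagrange n.+1 x) j.
have expand (f g : {poly R}) : (size f <= n.+1)%N -> (size g <= n.+1)%N ->
    B f g = \sum_(i < n.+1) f.[x i] * (\sum_(j < n.+1) g.[x j] * B (l i) (l j)).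
  move=> sf sg; rewrite symB.
  rewrite [X in B _ X](lagrange_gen (ltn0Sn n) x_inj sf) scalar_sum //.
  apply: eq_bigr => i _; congr (_ * _); rewrite symB.
  by rewrite [X in B _ X](lagrange_gen (ltn0Sn n) x_inj sg) scalar_sum.
have sVt := nbhs_singleton sV.
pose c (i : 'I_n.+1) (s : R) := \sum_(j < n.+1) (V s).[x j] * B (l i) (l j).
have dc i : is_derive t 1 (c i) (\sum_(j < n.+1) W.[x j] * B (l i) (l j)).
  rewrite /c -fct_sumE; apply: is_derive_sum => j.
  have := is_deriveM (dV _ (x_itv j)) (is_derive_cst (B (l i) (l j)) t 1).
  by rewrite scaler0 add0r => /is_derive_eq; apply; rewrite mulrC.
have dE : is_derive t 1 (fun s => \sum_(i < n.+1) (V s).[x i] * c i s)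
    (\sum_(i < n.+1) ((V t).[x i] * (\sum_(j < n.+1) W.[x j] * B (l i) (l j))
                      + W.[x i] * c i t)).
  rewrite -fct_sumE; apply: is_derive_sum => i.
  have := is_deriveM (dV _ (x_itv i)) (dc i).
  by move=> /is_derive_eq; apply; rewrite [c i t *: _]mulrC.
have {}dE : is_derive t 1 (fun s : R => B (V s) (V s))
    (\sum_(i < n.+1) ((V t).[x i] * (\sum_(j < n.+1) W.[x j] * B (l i) (l j))
                      + W.[x i] * c i t)).
  (* The expansion needs the size bound, available only for times near [t]. *)
  apply: near_eq_is_derive dE; near=> s.
  by rewrite expand //; near: s.
apply: (is_derive_eq dE).
by rewrite big_split /= -!expand // [B W _]symB mulr_natl mulr2n.
Unshelve. all: by end_near. Qed.

(** For degrees at most [p], this is the polar form of the energy on [-1, 1]: the p-th derivatives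
    are the constants p! f_p and p! g_p, and the length 2 cancels the 1/2 of c/2. *)
Definition esfr_form {R : realType} p (c : R) (f g : {poly R}) : R :=
  pint (f * g) + c * p`!%:R ^+ 2 * (f`_p * g`_p).

Lemma esfr_form_scalar {R : realType} p (c : R) f : scalar (@esfr_form R p c f).
Proof.
move=> a g h; rewrite /esfr_form mulrDr -scalerAr pintD pintZ coefD coefZ /=.
by ring.
Qed.

Lemma esfr_formC {R : realType} p (c : R) f g :
  @esfr_form R p c f g = esfr_form p c g f.
Proof. by rewrite /esfr_form mulrC [f`_p * _]mulrC. Qed.

(** * Change of variables to the reference element *)

Lemma elt_mapE {R : realType} (x : nat -> R) n :
  elt_map x n = jac x n *: 'X + ((x n + x n.+1) / 2)%:P.
Proof.
apply/polyP => i; rewrite /elt_map /jac.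
rewrite !(coefD, coefZ, coefN, coefX, coefC, coef1).
by case: i => [|[|i]] /=; field.
Qed.

Lemma horner_elt_map1 {R : realType} (x : nat -> R) n :
  (elt_map x n).[1] = x n.+1.
Proof. by rewrite elt_mapE !hornerE /jac; field. Qed.

Lemma horner_elt_mapN1 {R : realType} (x : nat -> R) n :
  (elt_map x n).[-1] = x n.
Proof. by rewrite elt_mapE !hornerE /jac; field. Qed.

Lemma deriv_elt_map {R : realType} (x : nat -> R) n :
  (elt_map x n)^`() = (jac x n)%:P.
Proof. by rewrite elt_mapE derivD derivZ derivX derivC addr0 alg_polyC. Qed.

Lemma size_comp_elt_map {R : realType} (x : nat -> R) n (v : {poly R}) m :
  (size v <= m)%N -> (size (v \Po elt_map x n) <= m)%N.
Proof.
have sm : (size (elt_map x n) <= 2)%N.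
  rewrite elt_mapE (leq_trans (size_polyD _ _)) // geq_max.
  rewrite (leq_trans (size_scale_leq _ _)) ?size_polyX //.
  by rewrite (leq_trans (size_polyC_leq1 _)).
case: (posnP (size v)) => [/eqP|v0 vm].
  by rewrite size_poly_eq0 => /eqP -> _; rewrite comp_poly0 size_poly0.
apply: (leq_trans (size_comp_poly_leq _ _)); apply: leq_trans vm.
rewrite -[X in (_ < X)%N](prednK v0) ltnS -[X in (_ <= X)%N]muln1 leq_mul //.
by case: (size _) sm.
Qed.

Lemma derivn_comp_elt_map {R : realType} (x : nat -> R) n (v : {poly R}) k :
  (v \Po elt_map x n)^`(k) = jac x n ^+ k *: (v^`(k) \Po elt_map x n).
Proof.
elim: k => [|k IHk]; first by rewrite !derivn0 expr0 scale1r.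
rewrite !derivnS IHk derivZ deriv_comp deriv_elt_map.
by rewrite [_ * _%:P]mulrC mul_polyC scalerA exprSr.
Qed.

Lemma Rintegral_elt {R : realType} (x : nat -> R) n (f : {poly R}) :
  x n < x n.+1 ->
  Rintegral (@lebesgue_measure R) `[x n, x n.+1] (horner f)
  = jac x n * pint (f \Po elt_map x n).
Proof.
move=> xn; rewrite Rintegral_horner // -pintZ.
have -> : jac x n *: (f \Po elt_map x n) = (antideriv f \Po elt_map x n)^`().
  by rewrite deriv_comp antiderivK deriv_elt_map [_ * _%:P]mulrC mul_polyC.
by rewrite pint_deriv !horner_comp horner_elt_map1 horner_elt_mapN1.
Qed.

(** The chain rule gives a factor J^p to each p-th derivative, which absorbs the weight J^(2p) of
    the norm; the remaining J is the Jacobian. *)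
Lemma Rintegral_energy {R : realType} p (x : nat -> R) n (c : R)
    (v : {poly R}) :
  x n < x n.+1 -> (size v <= p.+1)%N ->
  Rintegral (@lebesgue_measure R) `[x n, x n.+1]
    (fun y => v.[y] ^+ 2 + c / 2 * jac x n ^+ (2 * p) * (v^`(p)).[y] ^+ 2)
  = jac x n * esfr_form p c (v \Po elt_map x n) (v \Po elt_map x n).
Proof.
move=> xn sv.
pose f := v * v + (c / 2 * jac x n ^+ (2 * p)) *: (v^`(p) * v^`(p)).
have -> : (fun y => v.[y] ^+ 2 + c / 2 * jac x n ^+ (2 * p) * (v^`(p)).[y] ^+ 2)
    = horner f.
  by apply/funext => y; rewrite !hornerE -!expr2.
rewrite Rintegral_elt //; congr (_ * _).
set V := v \Po _; have sV : (size V <= p.+1)%N by exact: size_comp_elt_map.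
have -> : f \Po elt_map x n = V * V + (c / 2) *: (V^`(p) * V^`(p)).
  rewrite /f comp_polyD comp_polyZ !comp_polyM derivn_comp_elt_map.
  by rewrite mul2n -addnn exprD -!mul_polyC !polyCM /V; ring.
rewrite pintD pintZ derivn_lead // -polyCM.
have -> : pint ((p`!%:R * V`_p * (p`!%:R * V`_p))%:P) =
    2 * (p`!%:R * V`_p) ^+ 2.
  rewrite -[X in pint X]mulr1 mul_polyC pintZ -derivX pint_deriv !hornerX.
  by ring.
by rewrite /esfr_form; field.
Qed.

(** * Energy balance *)

(** The equation for u is tested with V and the one for q with V'. The parameter terms carried by Q'
    and V' vanish since their degree is below [p]; those of the correction functions are consumed by
    the ESFR property. The boundary values of Q cancel. *)
Lemma element_energy_balance {R : realType} p (J b kappa c : R)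
    (uL uR qL qR : R) (V Q : {poly R}) :
  (0 < p)%N -> J != 0 -> cminus R p < kappa -> cminus R p < c ->
  (size V <= p.+1)%N -> (size Q <= p.+1)%N ->
  Q = J^-1 *: (V^`() + (uL - V.[-1]) *: (corrL p kappa)^`()
                     + (uR - V.[1]) *: (corrR p kappa)^`()) ->
  J * esfr_form p c V ((b / J) *:
    (Q^`() + (qL - Q.[-1]) *: (corrL p c)^`()
           + (qR - Q.[1]) *: (corrR p c)^`()))
  = b * (- (pint (V^`() * V^`()) - (uL - V.[-1]) * V^`().[-1]
            + (uR - V.[1]) * V^`().[1]) / J
         + qR * V.[1] - qL * V.[-1]).
Proof.
move=> p0 J0 hk hc sV sQ QE.
have sV' := size_deriv_le _ _ sV.
have V'p : V^`()`_p = 0 by rewrite nth_default.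
have Q'p : Q^`()`_p = 0 by rewrite nth_default ?size_deriv_le.
have hQV : pint (Q * V^`()) = J^-1 * (pint (V^`() * V^`())
    - (uL - V.[-1]) * V^`().[-1] + (uR - V.[1]) * V^`().[1]).
  have := pint_deriv_corrL p0 hk _ (leqW sV').
  have := pint_deriv_corrR p0 hk _ (leqW sV').
  rewrite V'p mulr0 !mul0r !addr0 => hR hL.
  by rewrite {1}QE -scalerAl pintZ !mulrDl !pintD -!scalerAl !pintZ hL hR; ring.
have /(canRL (addrK _)) hL := pint_deriv_corrL p0 hc _ sV.
have /(canRL (addrK _)) hR := pint_deriv_corrR p0 hc _ sV.
have hQ := pint_by_parts Q V.
rewrite /esfr_form; set hl := (corrL p c)^`() in hL *.
set hr := (corrR p c)^`() in hR *; set a := qL - _; set d := qR - _.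
have -> : V * ((b / J) *: (Q^`() + a *: hl + d *: hr))
    = (b / J) *: (Q^`() * V + a *: (hl * V) + d *: (hr * V)).
  by rewrite -!mul_polyC; ring.
rewrite pintZ !pintD !pintZ coefZ !coefD !(coefZ a, coefZ d) Q'p hQ hQV hL hR.
by rewrite /a /d; field.
Qed.

Lemma tau_star_ge {R : realType} p N (x : nat -> R) (n : 'I_N) :
  (0 < p)%N -> (forall n : nat, (n < N)%N -> x n < x n.+1) ->
  (p * p.+1)%:R / (4 * jac x n) <= tau_star p N x.
Proof.
move=> p0 hx.
have J0 m : (m < N)%N -> 0 < jac x m.
  by move=> mN; rewrite divr_gt0 // subr_gt0 hx.
have -> : (p * p.+1)%:R / (4 * jac x n)
    = 2^-1 * (jac x n)^-1 * ((p * p.+1)%:R / 2).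
  have := lt0r_neq0 (J0 n (ltn_ord n)).
  move: (jac x n) ((p * p.+1)%:R) => J a h.
  by field.
apply: ler_pM.
- by rewrite mulr_ge0 ?invr_ge0 // ltW // J0.
- by rewrite divr_ge0.
- rewrite ler_wpM2l ?invr_ge0 //.
  exact: (le_bigmax _ (fun n : 'I_N => (jac x n)^-1)).
- apply: lb_le_inf; last by move=> _ [k hk <-]; exact: deriv_corrL_gap.
  (* The lower bound passes to the infimum only for a nonempty set of parameters. *)
  by eexists; exists (cminus R p + 1) => //=; rewrite ltrDl.
Qed.

(* The Young inequality that distributes the penalty [- tau [[u]]^2] of an
   interface: [vl, wl] are the traces of [u, u'] from the left, [vr, wr] those
   from the right. *)
Lemma ip_edge_le0 {R : realType} (tau vl vr wl wr um qm : R) : 0 < tau ->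
  um = (vl + vr) / 2 -> qm = (wl + wr) / 2 - tau * (vl - vr) ->
  ((um - vr) * wr - qm * vr - wr ^+ 2 / (2 * tau))
  + (- (um - vl) * wl + qm * vl - wl ^+ 2 / (2 * tau)) <= 0.
Proof.
move=> tau0 -> ->.
rewrite [leLHS](_ : _ = - ((tau * (vl - vr) - wr) ^+ 2
    + (tau * (vl - vr) - wl) ^+ 2) / (2 * tau)); last by field; rewrite gt_eqF.
by rewrite mulNr oppr_le0 divr_ge0 ?addr_ge0 ?sqr_ge0 // mulr_ge0 // ltW.
Qed.

(** * Energy decay on the periodic mesh *)

Lemma size_corrected_grad {R : realType} p N (x : nat -> R) (fL fR : {poly R})
    (v : 'I_N -> {poly R}) (vstar : 'I_N -> R) n :
  (size (v n) <= p.+1)%N -> (size fL <= p.+2)%N -> (size fR <= p.+2)%N ->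
  (size (corrected_grad x fL fR v vstar n) <= p.+1)%N.
Proof.
move=> sv sL sR; rewrite /corrected_grad.
have sV := size_comp_elt_map x n _ _ sv.
rewrite (leq_trans (size_polyD _ _)) // geq_max; apply/andP; split; last first.
  by rewrite (leq_trans (size_scale_leq _ _)) // size_deriv_le.
rewrite (leq_trans (size_polyD _ _)) // geq_max; apply/andP; split; last first.
  by rewrite (leq_trans (size_scale_leq _ _)) // size_deriv_le.
exact/leqW/size_deriv_le.
Qed.

Theorem theorem4p1 (R : realType) (p N : nat) (x : nat -> R)
  (b kappa c tau : R) (u q : R -> 'I_N -> {poly R})
  (hp : (1 <= p)%N) (hN : (1 <= N)%N)
  (hx : forall n : nat, (n < N)%N -> x n < x n.+1)
  (hb : 0 < b)
  (hkappa : cminus R p < kappa) (hc : cminus R p < c)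
  (hscheme : esfr_ip_solution p x b kappa c tau u q)
  (htau : tau_star p N x < tau) :
  forall t : R, 0 < t ->
    derivable (fun s : R => energy_norm p x c (u s) ^+ 2) t 1 /\
    derive1 (fun s : R => energy_norm p x c (u s) ^+ 2) t <= 0.
Proof.
move=> t t0.
have J0 (n : 'I_N) : 0 < jac x n by rewrite divr_gt0 // subr_gt0 hx.
have su (s : R) n : 0 < s -> (size (u s n) <= p.+1)%N.
  by move=> s0; have [] := hscheme s s0 n.
pose V (s : R) (n : 'I_N) := u s n \Po elt_map x n.
have sV (s : R) n : 0 < s -> (size (V s n) <= p.+1)%N.
  by move=> s0; exact/size_comp_elt_map/su.
pose W (n : 'I_N) := (b / jac x n) *: corrected_grad x (corrL p c) (corrR p c)
              (q t) (qstar x tau (u t)) n.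
have normE (s : R) : 0 < s -> energy_norm p x c (u s) ^+ 2
    = \sum_(n < N) jac x n * esfr_form p c (V s n) (V s n).
  move=> s0; rewrite /energy_norm.
  under eq_bigr => n _ do rewrite Rintegral_energy ?su ?hx //.
  rewrite sqr_sqrtr // sumr_ge0 // => n _; rewrite mulr_ge0 ?(ltW (J0 n)) //.
  have := energy_ge0 p c _ hc (sV s n s0).
  by rewrite /esfr_form exprMn mulrA -expr2.
have dE : is_derive t 1 (fun s : R => energy_norm p x c (u s) ^+ 2)
    (\sum_(n < N) jac x n * (2 * esfr_form p c (V t n) (W n))).
  apply: (@near_eq_is_derive _ _ _
    (fun s => \sum_(n < N) jac x n * esfr_form p c (V s n) (V s n))).
    by near=> s; rewrite normE //; near: s; exact: lt_nbhsr.
  rewrite -fct_sumE; apply: is_derive_sum => n.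
  apply: (@is_deriveZ _ _ _ (fun s => esfr_form p c (V s n) (V s n))).
  apply: (is_derive_quadratic _ (fun s => V s n) _ _ p) => //.
  - exact: esfr_form_scalar.
  - exact: esfr_formC.
  - by near=> s; apply: sV; near: s; exact: lt_nbhsr.
  - rewrite (leq_trans (size_scale_leq _ _)) // size_corrected_grad //.
    + by have [] := hscheme t t0 n.
    + exact: size_corrL.
    + exact: size_corrR.
  - move=> r hr; have [_ _ _ /(_ r hr)] := hscheme t t0 n.
    by rewrite /V /W hornerZ; under eq_fun => s do rewrite -horner_comp.
have [dd dv] := dE; split=> //; rewrite derive1E dv {dd dv dE}.
(* Here l and r denote the ends of element [n]; seen from an edge, the trace from the left is the r
   value of the element before it. *)
pose wl (n : 'I_N) := (u t n)^`().[x n].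
pose wr (n : 'I_N) := (u t n)^`().[x n.+1].
pose vl (n : 'I_N) := (u t n).[x n].
pose vr (n : 'I_N) := (u t n).[x n.+1].
pose us := ustar x (u t); pose qs := qstar x tau (u t).
have Vl n : (V t n).[-1] = vl n by rewrite horner_comp horner_elt_mapN1.
have Vr n : (V t n).[1] = vr n by rewrite horner_comp horner_elt_map1.
have V'l n : (V t n)^`().[-1] = wl n * jac x n.
  rewrite deriv_comp deriv_elt_map hornerM hornerC horner_comp.
  by rewrite horner_elt_mapN1.
have V'r n : (V t n)^`().[1] = wr n * jac x n.
  rewrite deriv_comp deriv_elt_map hornerM hornerC horner_comp.
  by rewrite horner_elt_map1.
have tau_ge (n : 'I_N) : (p * p.+1)%:R / (4 * jac x n) < tau.
  exact: le_lt_trans (tau_star_ge p N x n hp hx) htau.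
have tau0 : 0 < tau.
  apply: le_lt_trans (tau_ge (Ordinal hN)).
  by rewrite divr_ge0 // mulr_ge0 // ltW // J0.
(* The bound is split into a share for each end of the element, each receiving -w^2 / (2 tau) out of
   the dissipation. *)
have elt (n : 'I_N) : jac x n * (2 * esfr_form p c (V t n) (W n)) <= 2 * b *
    ((us n - vl n) * wl n - qs n * vl n - wl n ^+ 2 / (2 * tau)
     + (- (us (ordS n) - vr n) * wr n + qs (ordS n) * vr n
        - wr n ^+ 2 / (2 * tau))).
  have [_ sq qE _] := hscheme t t0 n; rewrite -/us in qE.
  set Q := q t n \Po elt_map x n in qE.
  have sQ : (size Q <= p.+1)%N by exact: size_comp_elt_map.
  have Ql : (q t n).[x n] = Q.[-1] by rewrite horner_comp horner_elt_mapN1.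
  have Qr : (q t n).[x n.+1] = Q.[1] by rewrite horner_comp horner_elt_map1.
  rewrite /corrected_grad -/(V t n) in qE.
  rewrite -[(u t n).[x n]]Vl -[(u t n).[x n.+1]]Vr in qE.
  rewrite mulrCA /W /corrected_grad -/qs -/Q Ql Qr.
  rewrite (element_energy_balance p _ b kappa c _ _ _ _ _ _ hp
            (lt0r_neq0 (J0 n)) hkappa hc (sV t n t0) sQ qE).
  rewrite mulrA ler_pM2l ?mulr_gt0 // Vl Vr V'l V'r.
  have := polynomial_trace _ _ hp (size_deriv_le _ _ (sV t n t0)).
  rewrite V'l V'r; set I := pint _ => hI.
  have hJ := J0 n; have := tau_ge n.
  rewrite ltr_pdivrMr; last exact: mulr_gt0.
  move=> hT.
  have I0 : 0 <= I by exact: pint_sqr_ge0.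
  (* The trace inequality for V' reads J^2 (wl^2 + wr^2) <= p (p + 1) / 2 I, and p (p + 1) / 2 < 2
     tau J by the choice of [tau]. *)
  have hI2 : (wl n ^+ 2 + wr n ^+ 2) / (2 * tau) <= I / jac x n.
    rewrite ler_pdivrMr ?mulr_gt0 // mulrAC ler_pdivlMr //.
    rewrite -(ler_pM2r hJ); apply: (le_trans (y := (p * p.+1)%:R / 2 * I)).
      by apply: le_trans hI; rewrite le_eqVlt; apply/orP; left; apply/eqP; ring.
    have := ler_wpM2r I0 (ltW hT); lra.
  rewrite -subr_ge0; rewrite -subr_ge0 in hI2; apply: (le_trans hI2).
  rewrite le_eqVlt; apply/orP; left; apply/eqP; field.
  by rewrite !gt_eqF.
apply: (le_trans (ler_sum _ (fun n _ => elt n))).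
rewrite -mulr_sumr pmulr_rle0 ?mulr_gt0 // big_split /=.
(* The shares of the right ends are reindexed by edges through the cyclic bijection [ordS], so that
   both shares of an interface meet in one summand. *)
pose G (e : 'I_N) :=
  - (us e - trace_left x (u t) e) * trace_left x (fun n => (u t n)^`()) e
  + qs e * trace_left x (u t) e
  - trace_left x (fun n => (u t n)^`()) e ^+ 2 / (2 * tau).
have GE : \sum_(n < N) (- (us (ordS n) - vr n) * wr n + qs (ordS n) * vr n
    - wr n ^+ 2 / (2 * tau)) = \sum_(e < N) G e.
  rewrite [RHS](reindex_inj (@ordS_inj N)); apply: eq_bigr => n _.
  by rewrite /G /trace_left ordSK.
rewrite GE -big_split /= sumr_le0 // => e _.
exact: ip_edge_le0.
Unshelve. all: by end_near. Qed.
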